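(* Let $\varphi:R\to S$ be a morphism of rings. Then the extension of scalars functor $\varphi^*=S\otimes_R(-):R\text{-}\mathrm{Mod}\to S\text{-}\mathrm{Mod}$ is semiseparable if and only if $\varphi$ is a regular morphism of $R$-bimodules, i.e. there is an $R$-bimodule map $E:S\to R$ such that $\varphi\circ E\circ\varphi=\varphi$, i.e., such that $\varphi(E(1_S))=1_S$.
   Context: Rings are unital and associative; $R\text{-}\mathrm{Mod}$ is the category of left $R$-modules; $S$ is an $R$-bimodule via $\varphi$. For a functor $F:\mathcal{C}\to\mathcal{D}$ let $\mathcal{F}^F:\mathrm{Hom}_{\mathcal{C}}(-,-)\to\mathrm{Hom}_{\mathcal{D}}(F-,F-)$ be the natural transformation (of functors $\mathcal{C}^{\mathrm{op}}\times\mathcal{C}\to\mathsf{Set}$) with $\mathcal{F}^F_{X,Y}(f)=F(f)$. $F$ is semiseparable if there is a natural transformation $\mathcal{P}^F:\mathrm{Hom}_{\mathcal{D}}(F-,F-)\to\mathrm{Hom}_{\mathcal{C}}(-,-)$ with $\mathcal{F}^F\circ\mathcal{P}^F\circ\mathcal{F}^F=\mathcal{F}^F$. A morphism $f$ in a category is regular if there is a morphism $g$ in that category with $f\circ g\circ f=f$. *)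

(* Defs.v *)
From HB Require Import structures.
From mathcomp Require Import all_boot all_algebra.
From mathcomp Require Import ring_quotient boolp freeg.

Set Implicit Arguments.
Unset Strict Implicit.
Unset Printing Implicit Defensive.

Import GRing.Theory.

Local Open Scope ring_scope.

Record category := Category {
  obj :> Type;
  arr : obj -> obj -> Type;
  idm : forall X, arr X X;
  compm : forall X Y Z, arr Y Z -> arr X Y -> arr X Z;
  comp1m : forall X Y (f : arr X Y), compm (idm Y) f = f;
  compm1 : forall X Y (f : arr X Y), compm f (idm X) = f;
  compmA : forall X Y Z T (h : arr Z T) (g : arr Y Z) (f : arr X Y),
    compm h (compm g f) = compm (compm h g) f
}.

Arguments arr {c} X Y.
Arguments idm {c} X.
Arguments compm {c X Y Z} g f.

Record functor (C D : category) := Functor {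
  fobj :> C -> D;
  fmap : forall X Y, arr X Y -> arr (fobj X) (fobj Y);
  fmap1 : forall X, fmap (idm X) = idm (fobj X);
  fmapM : forall X Y Z (g : arr Y Z) (f : arr X Y),
    fmap (compm g f) = compm (fmap g) (fmap f)
}.

Arguments fmap {C D} F {X Y} f : rename.

(* P is a natural transformation Hom_D(F -, F -) -> Hom_C(-, -) of functors
   C^op x C -> Set: (h, k) below is a morphism (X, Y) -> (X', Y') of
   C^op x C, acting on Hom_C by f |-> k f h and on Hom_D by
   g |-> F(k) g F(h). *)
Definition arr_natural (C D : category) (F : functor C D)
    (P : forall X Y : C, arr (F X) (F Y) -> arr X Y) :=
  forall (X X' Y Y' : C) (h : arr X' X) (k : arr Y Y') (g : arr (F X) (F Y)),
    P X' Y' (compm (fmap F k) (compm g (fmap F h)))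
    = compm k (compm (P X Y g) h).

Definition semiseparable (C D : category) (F : functor C D) :=
  exists P : forall X Y : C, arr (F X) (F Y) -> arr X Y,
    arr_natural P /\
    forall (X Y : C) (f : arr X Y), fmap F (P X Y (fmap F f)) = fmap F f.

Definition regular_morphism (C : category) (X Y : C) (f : arr X Y) :=
  exists g : arr Y X, compm f (compm g f) = f.

Section ModuleCategory.
Variable R : pzRingType.

Lemma linear_ext (X Y : lmodType R) (f g : {linear X -> Y}) : f =1 g -> f = g.
Proof.
case: f g => [f [[nf] [sf]]] [g [[ng] [sg]]] /= /funext efg.
rewrite -/f -/g in efg; subst g.
by rewrite (Prop_irrelevance nf ng) (Prop_irrelevance sf sg).
Qed.

Definition lin_id (X : lmodType R) : {linear X -> X} := idfun.

Definition lin_comp (X Y Z : lmodType R)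
  (g : {linear Y -> Z}) (f : {linear X -> Y}) : {linear X -> Z} := g \o f.

Definition modCat : category.
Proof.
by apply: (@Category (lmodType R) (fun X Y => {linear X -> Y})
             lin_id lin_comp) => *; apply: linear_ext.
Defined.

End ModuleCategory.

Section Bimodules.
Variable R : pzRingType.

(* R-R-bimodules: rscale is the right action, the left action is *: *)
Record bimodType := Bimod {
  bimod_sort :> lmodType R;
  rscale : bimod_sort -> R -> bimod_sort;
  rscaleA : forall x a b, rscale (rscale x a) b = rscale x (a * b);
  rscale1 : forall x, rscale x 1 = x;
  rscaleDl : forall x y a, rscale (x + y) a = rscale x a + rscale y a;
  rscaleDr : forall x a b, rscale x (a + b) = rscale x a + rscale x b;
  lrscaleA : forall a x b, rscale (a *: x) b = a *: rscale x b
}.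

Record bimodHom (M N : bimodType) := BimodHom {
  bimod_fun :> {linear M -> N};
  bimod_funZr : forall x a, bimod_fun (rscale x a) = rscale (bimod_fun x) a
}.

Lemma bimodHom_ext (M N : bimodType) (f g : bimodHom M N) : f =1 g -> f = g.
Proof.
case: f g => [f fZ] [g gZ] /= /linear_ext efg; subst g.
by rewrite (Prop_irrelevance fZ gZ).
Qed.

Definition bimod_id (M : bimodType) : bimodHom M M :=
  @BimodHom M M (lin_id M) (fun _ _ => erefl).

Lemma bimod_comp_subproof (M N P : bimodType)
    (g : bimodHom N P) (f : bimodHom M N) x a :
  lin_comp g f (rscale x a) = rscale (lin_comp g f x) a.
Proof. by rewrite /= !bimod_funZr. Qed.

Definition bimod_comp (M N P : bimodType)
    (g : bimodHom N P) (f : bimodHom M N) : bimodHom M P :=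
  BimodHom (bimod_comp_subproof g f).

Definition bimodCat : category.
Proof.
by apply: (@Category bimodType bimodHom bimod_id bimod_comp) => *;
  apply: bimodHom_ext.
Defined.

Definition regular_bimod : bimodType.
Proof.
apply: (@Bimod R^o (fun (x : R) (a : R) => x * a)) => *.
- by rewrite mulrA.
- by rewrite mulr1.
- by rewrite mulrDl.
- by rewrite mulrDr.
- by rewrite /GRing.scale /= mulrA.
Defined.

End Bimodules.

Section RestrictionOfScalars.
Variables (R S : pzRingType) (phi : {rmorphism R -> S}).

(* S as a left R-module: a *: s = phi a * s. *)
Definition restr of {rmorphism R -> S} : Type := S.
Local Notation Sphi := (restr phi).

HB.instance Definition _ := GRing.Zmodule.on Sphi.

Definition restr_scale (a : R) (s : Sphi) : Sphi := phi a * (s : S).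

Fact restr_scaleA a b s :
  restr_scale a (restr_scale b s) = restr_scale (a * b) s.
Proof. by rewrite /restr_scale rmorphM mulrA. Qed.
Fact restr_scale1 : left_id 1 restr_scale.
Proof. by move=> s; rewrite /restr_scale rmorph1 mul1r. Qed.
Fact restr_scaleDr : right_distributive restr_scale +%R.
Proof. by move=> a s t; apply: mulrDr. Qed.
Fact restr_scaleDl s : {morph restr_scale^~ s : a b / a + b}.
Proof. by move=> a b; rewrite /restr_scale rmorphD; apply: mulrDl. Qed.

HB.instance Definition _ := GRing.Zmodule_isLmodule.Build R Sphi
  restr_scaleA restr_scale1 restr_scaleDr restr_scaleDl.

Definition restr_bimod : bimodType R.
Proof.
apply: (@Bimod R Sphi (fun (s : S) (a : R) => s * phi a)) => *.
- by rewrite rmorphM mulrA.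
- by rewrite rmorph1 mulr1.
- exact: mulrDl.
- by rewrite rmorphD; exact: mulrDr.
- by rewrite /GRing.scale /= /restr_scale mulrA.
Defined.

Definition restr_phi (r : R^o) : Sphi := phi r.

Fact restr_phi_nmod : nmod_morphism restr_phi.
Proof. by split=> [|x y]; rewrite /restr_phi ?rmorph0 ?rmorphD. Qed.
Fact restr_phi_scalable : scalable restr_phi.
Proof. by move=> a x; rewrite /restr_phi rmorphM. Qed.

HB.instance Definition _ :=
  GRing.isNmodMorphism.Build R^o Sphi restr_phi restr_phi_nmod.
HB.instance Definition _ :=
  GRing.isScalable.Build R R^o Sphi *:%R restr_phi restr_phi_scalable.

Definition phi_bimod : bimodHom (regular_bimod R) restr_bimod.
Proof.
apply: (@BimodHom R (regular_bimod R) restr_bimod restr_phi) => x a.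
by rewrite /= /restr_phi rmorphM.
Defined.

End RestrictionOfScalars.

Section TensorProduct.
Variables (R S : pzRingType) (phi : {rmorphism R -> S}).

Section Module.
Variable M : lmodType R.

(* The subgroup of the free abelian group on S x M generated by the relators
   of S (x)_R M, where R acts on the right of S by s . a = s * phi a. *)
Inductive tensor_null : {freeg (S * M)%type} -> Prop :=
| tensor_null0 : tensor_null 0
| tensor_nullB u v of tensor_null u & tensor_null v : tensor_null (u - v)
| tensor_nullDl s s' m :
    tensor_null (<< (s + s', m) >> - (<< (s, m) >> + << (s', m) >>))
| tensor_nullDr s m m' :
    tensor_null (<< (s, m + m') >> - (<< (s, m) >> + << (s, m') >>))
| tensor_nullZ s a m :
    tensor_null (<< (s * phi a, m) >> - << (s, a *: m) >>).

Definition tensor_ker : pred {freeg (S * M)%type} :=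
  fun u => `[< tensor_null u >].

Fact tensor_ker_zmod_closed : zmod_closed tensor_ker.
Proof.
split=> [|u v]; rewrite !unfold_in; first by apply/asboolP; constructor.
by move=> /asboolP nu /asboolP nv; apply/asboolP; constructor.
Qed.

HB.instance Definition _ :=
  GRing.isZmodClosed.Build {freeg (S * M)%type} tensor_ker
    tensor_ker_zmod_closed.

Definition tensor_kernel : zmodClosed {freeg (S * M)%type} :=
  GRing.ZmodClosed.clone _ tensor_ker _.

Definition tensor : Type := {ideal_quot tensor_kernel}.

HB.instance Definition _ := GRing.Zmodule.on tensor.

Definition tensor_pi (u : {freeg (S * M)%type}) : tensor :=
  \pi_({ideal_quot tensor_kernel})%qT u.

Definition tens (s : S) (m : M) : tensor := tensor_pi << (s, m) >>.

Fact tensor_pi_zmod_morphism : zmod_morphism tensor_pi.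
Proof. exact: (raddfB (\pi_({ideal_quot tensor_kernel})%qT)). Qed.

HB.instance Definition _ :=
  GRing.isZmodMorphism.Build _ tensor tensor_pi tensor_pi_zmod_morphism.

Lemma tensor_piP u v : tensor_pi u = tensor_pi v <-> tensor_null (u - v).
Proof.
rewrite /tensor_pi; split=> [/eqP|nuv].
  by rewrite -Quotient.idealrBE unfold_in => /asboolP.
by apply/eqP; rewrite -Quotient.idealrBE unfold_in; apply/asboolP.
Qed.

Lemma tensDl s s' m : tens (s + s') m = tens s m + tens s' m.
Proof. by rewrite /tens -raddfD; apply/tensor_piP; constructor. Qed.

Lemma tensDr s m m' : tens s (m + m') = tens s m + tens s m'.
Proof. by rewrite /tens -raddfD; apply/tensor_piP; constructor. Qed.

Lemma tensZ s a m : tens (s * phi a) m = tens s (a *: m).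
Proof. by apply/tensor_piP; constructor. Qed.

Lemma additive_tensor_ext (V : zmodType) (f g : {additive tensor -> V}) :
  (forall s m, f (tens s m) = g (tens s m)) -> f =1 g.
Proof.
move=> fg t; have fg_pi u : f (tensor_pi u) = g (tensor_pi u).
  rewrite -[u]Freeg_dom; elim: (dom _) => [|p l IHl] /=.
    by rewrite freeg_nil !raddf0.
  rewrite -cat1s freeg_cat !raddfD IHl; congr (_ + _).
  rewrite -[coeff _ _]intz -freegU_mulz !raddfMz; congr (_ *~ _).
  by case: p => s m; apply: fg.
by rewrite -[t]reprK; apply: fg_pi.
Qed.

Lemma tensor_ext (V : zmodType) (f g : tensor -> V) :
    zmod_morphism f -> zmod_morphism g ->
  (forall s m, f (tens s m) = g (tens s m)) -> f =1 g.
Proof.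
move=> fB gB.
pose fM := GRing.isZmodMorphism.Build _ _ f fB.
pose gM := GRing.isZmodMorphism.Build _ _ g gB.
exact: (@additive_tensor_ext V (HB.pack f fM) (HB.pack g gM)).
Qed.

Section Lift.
Variables (V : zmodType) (f : S -> M -> V).

(* R-balanced biadditive maps, i.e. those factoring through S (x)_R M. *)
Record balanced : Prop := Balanced {
  balancedDl : forall s s' m, f (s + s') m = f s m + f s' m;
  balancedDr : forall s m m', f s (m + m') = f s m + f s m';
  balancedZ : forall s a m, f (s * phi a) m = f s (a *: m)
}.

Definition free_lift (u : {freeg (S * M)%type}) : V :=
  fglift (fun p => f p.1 p.2 : zmodule V) u.

Fact free_lift_zmod_morphism : zmod_morphism free_lift.
Proof. exact: (@lift_is_additive _ _ (zmodule V)). Qed.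

HB.instance Definition _ :=
  GRing.isZmodMorphism.Build {freeg (S * M)%type} V free_lift
    free_lift_zmod_morphism.

Lemma free_liftU s m : free_lift << (s, m) >> = f s m.
Proof. by rewrite /free_lift liftU scale1r. Qed.

Definition tensor_lift (t : tensor) : V := free_lift (repr t).

Hypothesis f_bal : balanced.

Lemma tensor_lift_pi u : tensor_lift (tensor_pi u) = free_lift u.
Proof.
apply/subr0_eq; rewrite -raddfB.
have: tensor_null (repr (tensor_pi u) - u).
  by apply/tensor_piP; rewrite /tensor_pi reprK.
elim=> [|v w _ v0 _ w0|s s' m|s m m'|s a m].
- exact: raddf0.
- by rewrite raddfB /= v0 w0 subrr.
- by rewrite raddfB raddfD /= !free_liftU (balancedDl f_bal) subrr.
- by rewrite raddfB raddfD /= !free_liftU (balancedDr f_bal) subrr.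
- by rewrite raddfB /= !free_liftU (balancedZ f_bal) subrr.
Qed.

Lemma tensor_liftE s m : tensor_lift (tens s m) = f s m.
Proof. by rewrite tensor_lift_pi free_liftU. Qed.

Lemma tensor_lift_zmod_morphism : zmod_morphism tensor_lift.
Proof.
move=> t u; rewrite -[t]reprK -[u]reprK -!/(tensor_pi _) -raddfB.
by rewrite !tensor_lift_pi raddfB.
Qed.

End Lift.

Definition tensor_scale (s : S) : tensor -> tensor :=
  tensor_lift (fun s' m => tens (s * s') m).

Fact tensor_scale_balanced s : balanced (fun s' m => tens (s * s') m).
Proof.
split=> *; first by rewrite mulrDr tensDl.
- exact: tensDr.
- by rewrite mulrA tensZ.
Qed.

Lemma tensor_scaleE s s' m : tensor_scale s (tens s' m) = tens (s * s') m.
Proof. exact/tensor_liftE/tensor_scale_balanced. Qed.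

Fact tensor_scaleB s : zmod_morphism (tensor_scale s).
Proof. exact/tensor_lift_zmod_morphism/tensor_scale_balanced. Qed.

Fact tensor_scaleA s s' t :
  tensor_scale s (tensor_scale s' t) = tensor_scale (s * s') t.
Proof.
apply: (tensor_ext (f := fun t => tensor_scale s (tensor_scale s' t))) t.
- by move=> t u /=; rewrite !tensor_scaleB.
- exact: tensor_scaleB.
- by move=> s1 m /=; rewrite !tensor_scaleE mulrA.
Qed.

Fact tensor_scale1 : left_id 1 tensor_scale.
Proof.
apply: tensor_ext => [|//|s m]; first exact: tensor_scaleB.
by rewrite tensor_scaleE mul1r.
Qed.

Fact tensor_scaleDr : right_distributive tensor_scale +%R.
Proof.
move=> s.
pose sB := GRing.isZmodMorphism.Build _ _ (tensor_scale s) (tensor_scaleB s).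
exact: (raddfD (HB.pack (tensor_scale s) sB : {additive tensor -> tensor})).
Qed.

Fact tensor_scaleDl t : {morph tensor_scale^~ t : a b / a + b}.
Proof.
move=> a b.
apply: (tensor_ext (g := fun t => tensor_scale a t + tensor_scale b t)) t.
- exact: tensor_scaleB.
- by move=> t u; rewrite !tensor_scaleB opprD addrACA.
- by move=> s m; rewrite !tensor_scaleE mulrDl tensDl.
Qed.

HB.instance Definition _ := GRing.Zmodule_isLmodule.Build S tensor
  tensor_scaleA tensor_scale1 tensor_scaleDr tensor_scaleDl.

Lemma scale_tens (s s' : S) m : s *: tens s' m = tens (s * s') m.
Proof. exact: tensor_scaleE. Qed.


End Module.

Section Map.
Variables (M N : lmodType R) (f : {linear M -> N}).

Definition tensor_map : tensor M -> tensor N :=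
  tensor_lift (fun s m => tens s (f m)).

Fact tensor_map_balanced : balanced (fun s m => tens s (f m)).
Proof.
split=> *; first exact: tensDl.
- by rewrite linearD tensDr.
- by rewrite linearZ tensZ.
Qed.

Lemma tensor_mapE s m : tensor_map (tens s m) = tens s (f m).
Proof. exact/tensor_liftE/tensor_map_balanced. Qed.

Fact tensor_map_zmod_morphism : zmod_morphism tensor_map.
Proof. exact/tensor_lift_zmod_morphism/tensor_map_balanced. Qed.

HB.instance Definition _ :=
  GRing.isZmodMorphism.Build (tensor M) (tensor N) tensor_map
    tensor_map_zmod_morphism.

Fact tensor_map_scalable : scalable tensor_map.
Proof.
move=> s; apply: (tensor_ext (f := fun t => tensor_map (s *: t))).
- by move=> t u; rewrite scalerBr raddfB.
- by move=> t u; rewrite raddfB scalerBr.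
- by move=> s' m; rewrite scale_tens !tensor_mapE scale_tens.
Qed.

HB.instance Definition _ :=
  GRing.isScalable.Build S (tensor M) (tensor N) *:%R tensor_map
    tensor_map_scalable.

End Map.

Definition tensor_hom (M N : lmodType R) (f : {linear M -> N}) :
  {linear tensor M -> tensor N} := tensor_map f.

Fact tensor_hom1 (M : lmodType R) : tensor_hom (lin_id M) = lin_id (tensor M).
Proof.
apply/linear_ext/tensor_ext => [||s m /=]; [exact: raddfB|by []|].
by rewrite tensor_mapE.
Qed.

Fact tensor_homM (M N P : lmodType R)
    (g : {linear N -> P}) (f : {linear M -> N}) :
  tensor_hom (lin_comp g f) = lin_comp (tensor_hom g) (tensor_hom f).
Proof.
apply/linear_ext/tensor_ext => [||s m /=]; [exact: raddfB|exact: raddfB|].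
by rewrite !tensor_mapE.
Qed.

Definition extension_of_scalars : functor (modCat R) (modCat S) :=
  @Functor (modCat R) (modCat S) (fun M => tensor M) tensor_hom
    tensor_hom1 tensor_homM.

End TensorProduct.

(* Main.v *)
Require Import Defs.
From HB Require Import structures.
From mathcomp Require Import all_boot all_algebra.

Set Implicit Arguments.
Unset Strict Implicit.
Unset Printing Implicit Defensive.

Import GRing.Theory.

Local Open Scope ring_scope.

(* If phi (E 1) = 1, the maps s (x) n |-> E s *: n are R-linear and natural in
   N, and composing them with m |-> g (1 (x) m) sends g : S (x) M -> S (x) N to
   a map M -> N; this is a natural splitting P.  Conversely, given P, let
   mu : S (x) S -> S (x) R send s (x) t to s t (x) 1 and put E := P mu.  As
   mu o F(phi) = id, naturality gives E o phi = P (F id), so that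
   F(E o phi) = id, and evaluating at 1 (x) 1 yields phi (E 1) = 1; right
   R-linearity of E is naturality of P with respect to right
   multiplications. *)

Section ExtensionOfScalars.
Variables (R S : pzRingType) (phi : {rmorphism R -> S}).

(** Left linearity of [E] gives [E (phi r) = r * E 1], because [phi r] is [r] acting on [1]; hence
    [phi (E (phi r)) = phi r * phi (E 1)]. *)
Lemma phi_quasi_inverseP (E : bimodHom (restr_bimod phi) (regular_bimod R)) :
  (forall r : R, phi (E (phi r)) = phi r) <-> phi (E (1 : S)) = 1.
Proof.
split=> [phiE|phiE1 r]; first by rewrite -(rmorph1 phi) phiE.
have ErE : E (phi r) = r * E (1 : S).
  by rewrite -[phi r]mulr1; exact: (linearZ_LR E r ((1 : S) : restr_bimod phi)).
by rewrite ErE rmorphM phiE1 mulr1.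
Qed.

Lemma regular_phi_bimodP :
  @regular_morphism (bimodCat R) (regular_bimod R) (restr_bimod phi)
    (phi_bimod phi) <->
  exists E : bimodHom (restr_bimod phi) (regular_bimod R),
    forall r : R, phi (E (phi r)) = phi r.
Proof.
split=> [[E phiE]|[E phiE]]; exists E.
  by move=> r; apply: (congr1
    (fun f : bimodHom (regular_bimod R) (restr_bimod phi) => f r) phiE).
by apply: bimodHom_ext => r; apply: phiE.
Qed.

(** * From a bimodule map to a splitting of the functor *)

Section OfQuasiInverse.
Variable E : bimodHom (restr_bimod phi) (regular_bimod R).

(** This is [E] tensored with [N], followed by the canonical isomorphism of R ⊗_R N with [N]. Right
    linearity of [E] makes it balanced. *)
Definition tensor_act (N : lmodType R) : tensor phi N -> N :=
  tensor_lift (fun (s : S) (n : N) => (E s : R) *: n).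

Fact tensor_act_balanced (N : lmodType R) :
  balanced phi (fun (s : S) (n : N) => (E s : R) *: n).
Proof.
split=> [s s' n|s n n'|s a n].
- by rewrite -scalerDl; congr (_ *: _); apply: (raddfD E).
- exact: scalerDr.
- by rewrite scalerA; congr (_ *: _); apply: (bimod_funZr E s a).
Qed.

Lemma tensor_actE (N : lmodType R) s (n : N) :
  tensor_act (tens phi s n) = (E s : R) *: n.
Proof. exact/tensor_liftE/tensor_act_balanced. Qed.

Fact tensor_act_zmod_morphism (N : lmodType R) : zmod_morphism (@tensor_act N).
Proof. exact/tensor_lift_zmod_morphism/tensor_act_balanced. Qed.

HB.instance Definition _ (N : lmodType R) :=
  GRing.isZmodMorphism.Build (tensor phi N) N (@tensor_act N)
    (@tensor_act_zmod_morphism N).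

(** Here left linearity of [E] enters. The source is an [S]-module, so [R] acts on it through
    [phi]. *)
Lemma tensor_actZ (N : lmodType R) a (t : tensor phi N) :
  tensor_act (phi a *: t) = a *: tensor_act t.
Proof.
apply: (tensor_ext (f := fun t => tensor_act (phi a *: t))
                   (g := fun t => a *: tensor_act t)) t.
- by move=> t u; rewrite scalerBr raddfB.
- by move=> t u; rewrite raddfB scalerBr.
move=> s n; rewrite scale_tens !tensor_actE scalerA; congr (_ *: _).
exact: (linearZ_LR E a (s : restr_bimod phi)).
Qed.

Lemma tensor_act_natural (M N : lmodType R) (f : {linear M -> N})
    (t : tensor phi M) :
  tensor_act (tensor_map f t) = f (tensor_act t).
Proof.
apply: (tensor_ext (f := fun t => tensor_act (tensor_map f t))
                   (g := fun t => f (tensor_act t))) t.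
- by move=> t u; rewrite !raddfB.
- by move=> t u; rewrite !raddfB.
by move=> s m; rewrite tensor_mapE !tensor_actE linearZ.
Qed.

Section Descent.
Variables (M N : lmodType R) (g : {linear tensor phi M -> tensor phi N}).

Definition descent (m : M) : N := tensor_act (g (tens phi 1 m)).

Fact descent_zmod_morphism : zmod_morphism descent.
Proof.
move=> m n; rewrite /descent.
have tensB : tens phi 1 (m - n) = tens phi 1 m - tens phi 1 n.
  by apply: (addIr (tens phi 1 n)); rewrite -tensDr !subrK.
by rewrite tensB !raddfB.
Qed.

Fact descent_scalable : scalable descent.
Proof.
(* The scalar crosses the tensor sign, 1 ⊗ am = phi(a) ⊗ m = phi(a)(1 ⊗ m), and then leaves [g] by
   [S]-linearity. *)
move=> a m; rewrite /descent -tensZ mul1r -[phi a]mulr1 -scale_tens linearZ.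
exact: tensor_actZ.
Qed.

HB.instance Definition _ :=
  GRing.isZmodMorphism.Build M N descent descent_zmod_morphism.
HB.instance Definition _ :=
  GRing.isScalable.Build R M N *:%R descent descent_scalable.

Definition descent_hom : {linear M -> N} := descent.

End Descent.

Lemma semiseparable_of_quasi_inverse :
  phi (E (1 : S)) = 1 -> semiseparable (extension_of_scalars phi).
Proof.
move=> phiE1; exists descent_hom; split.
  move=> X X' Y Y' h k g; apply: linear_ext => m /=.
  by rewrite /descent /= tensor_mapE tensor_act_natural.
move=> X Y f; apply/linear_ext/tensor_ext => [||s m /=]; try exact: raddfB.
(* The splitting turns F(f) into m ↦ E(1) f(m), and s ⊗ E(1) f(m) = s phi(E(1)) ⊗ f(m). *)
rewrite !tensor_mapE /= /descent /= tensor_mapE tensor_actE.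
by rewrite -tensZ phiE1 mulr1.
Qed.

End OfQuasiInverse.

(** * From a splitting of the functor to a bimodule map *)

Section ToQuasiInverse.

(** Right multiplications are left linear, hence arrows of [modCat R] at which naturality can be
    applied. *)
Definition rmul_restr (a : R) (s : restr phi) : restr phi := (s : S) * phi a.

Fact rmul_restr_linear a : linear (rmul_restr a).
Proof.
move=> b s t; rewrite /rmul_restr [in LHS]/GRing.scale /= /restr_scale.
by rewrite mulrDl -mulrA.
Qed.

HB.instance Definition _ a :=
  GRing.isLinear.Build R (restr phi) (restr phi) *:%R (rmul_restr a)
    (rmul_restr_linear a).

Definition rmul_reg (a : R) (x : R^o) : R^o := (x : R) * a.

Fact rmul_reg_linear a : linear (rmul_reg a).
Proof. by move=> b x y; rewrite /rmul_reg mulrDl -mulrA. Qed.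

HB.instance Definition _ a :=
  GRing.isLinear.Build R R^o R^o *:%R (rmul_reg a) (rmul_reg_linear a).

(** The multiplication of [S], with values in S ⊗_R R instead of [S], since [P] only accepts arrows
    between extended modules. *)
Definition tensor_mul : tensor phi (restr phi) -> tensor phi R^o :=
  tensor_lift (fun (s : S) (t : restr phi) =>
    tens phi (s * (t : S)) (1 : R^o)).

Fact tensor_mul_balanced :
  balanced phi (fun (s : S) (t : restr phi) =>
    tens phi (s * (t : S)) (1 : R^o)).
Proof.
split=> *; first by rewrite mulrDl tensDl.
- by rewrite -tensDl -mulrDr.
- by rewrite -mulrA.
Qed.

Lemma tensor_mulE s (t : restr phi) :
  tensor_mul (tens phi s t) = tens phi (s * (t : S)) (1 : R^o).
Proof. exact/tensor_liftE/tensor_mul_balanced. Qed.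

Fact tensor_mul_zmod_morphism : zmod_morphism tensor_mul.
Proof. exact/tensor_lift_zmod_morphism/tensor_mul_balanced. Qed.

HB.instance Definition _ :=
  GRing.isZmodMorphism.Build (tensor phi (restr phi)) (tensor phi R^o)
    tensor_mul tensor_mul_zmod_morphism.

Fact tensor_mul_scalable : scalable tensor_mul.
Proof.
move=> s; apply: (tensor_ext (f := fun t => tensor_mul (s *: t))
                             (g := fun t => s *: tensor_mul t)).
- by move=> t u; rewrite scalerBr raddfB.
- by move=> t u; rewrite raddfB scalerBr.
- by move=> s' m; rewrite scale_tens !tensor_mulE scale_tens mulrA.
Qed.

HB.instance Definition _ :=
  GRing.isScalable.Build S (tensor phi (restr phi)) (tensor phi R^o)
    *:%R tensor_mul tensor_mul_scalable.

(** The canonical isomorphism of S ⊗_R R with [S], which turns an equality of tensors into one in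
    [S]. *)
Definition tensor_reg : tensor phi R^o -> S :=
  tensor_lift (fun (s : S) (r : R^o) => s * phi r).

Lemma tensor_regE s (r : R^o) : tensor_reg (tens phi s r) = s * phi r.
Proof.
apply: tensor_liftE; split=> [s' s'' r'|s' r' r''|s' a r'].
- exact: mulrDl.
- by rewrite rmorphD mulrDr.
- by rewrite rmorphM mulrA.
Qed.

(** A normal form s ⊗ 1 for pure tensors of S ⊗_R R, in which values of [mu] are compared. *)
Lemma tens_reg s (r : R^o) : tens phi s r = tens phi (s * phi r) (1 : R^o).
Proof. by rewrite tensZ [r *: _]mulr1. Qed.

Lemma quasi_inverse_of_semiseparable :
  semiseparable (extension_of_scalars phi) ->
  exists E : bimodHom (restr_bimod phi) (regular_bimod R),
    phi (E (1 : S)) = 1.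
Proof.
case=> P [Pnat PF].
pose mu : {linear tensor phi (restr phi) -> tensor phi R^o} := tensor_mul.
pose E : {linear restr phi -> R^o} := P (restr phi) R^o mu.
have EZr (s : restr phi) a : E (rmul_restr a s) = rmul_reg a (E s).
  pose ra : {linear restr phi -> restr phi} := rmul_restr a.
  pose la : {linear R^o -> R^o} := rmul_reg a.
  have PmuE : lin_comp E ra = lin_comp la E.
    have := Pnat _ _ _ _ ra (lin_id R^o) mu.
    have := Pnat _ _ _ _ (lin_id (restr phi)) la mu.
    rewrite !fmap1 /= => eq1 eq2.
    (* Naturality acts on both sides at once, so each side is padded with an identity. *)
    transitivity (lin_comp (lin_id R^o) (lin_comp E ra)).
      exact: linear_ext.
    transitivity (lin_comp la (lin_comp E (lin_id (restr phi)))); last first.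
      exact: linear_ext.
    rewrite -[LHS]eq2 -[RHS]eq1; congr (P _ _ _).
    (* Both arrows under [P] send s' ⊗ t to s' t phi(a) ⊗ 1. *)
    apply/linear_ext/tensor_ext => [||s' t /=]; try exact: raddfB.
    rewrite tensor_mapE /= !tensor_mulE [in RHS]tensor_mapE.
    by rewrite [RHS]tens_reg /= /rmul_restr /rmul_reg mul1r mulrA.
  by have /(congr1 (fun f : {linear _ -> _} => f s)) := PmuE.
exists (@BimodHom R (restr_bimod phi) (regular_bimod R) E EZr) => /=.
pose f : {linear R^o -> restr phi} := @restr_phi R S phi.
have Ef : lin_comp E f = P R^o R^o (tensor_hom phi (lin_id R^o)).
  have := Pnat _ _ _ _ f (lin_id R^o) mu.
  rewrite fmap1 /= => eq1.
  transitivity (lin_comp (lin_id R^o) (lin_comp E f)); first exact: linear_ext.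
  rewrite -[LHS]eq1; congr (P _ _ _).
  apply/linear_ext/tensor_ext => [||s t /=]; try exact: raddfB.
  by rewrite !tensor_mapE /= tensor_mulE [RHS]tens_reg.
have := PF R^o R^o (lin_id R^o); rewrite /= -Ef.
(* At 1 ⊗ 1 the two sides become phi(E(phi(1))) and phi(1) in [S]. *)
move=> /(congr1 (fun h : {linear _ -> _} =>
                   tensor_reg (h (tens phi 1 (1 : R^o))))) /=.
by rewrite !tensor_mapE /= !tensor_regE !mul1r /restr_phi rmorph1.
Qed.

End ToQuasiInverse.

End ExtensionOfScalars.

Theorem proposition3p1 (R S : pzRingType) (phi : {rmorphism R -> S}) :
  (semiseparable (extension_of_scalars phi) <->
     @regular_morphism (bimodCat R) (regular_bimod R) (restr_bimod phi)
       (phi_bimod phi)) /\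
  (@regular_morphism (bimodCat R) (regular_bimod R) (restr_bimod phi)
     (phi_bimod phi) <->
     exists E : bimodHom (restr_bimod phi) (regular_bimod R),
       forall r : R, phi (E (phi r)) = phi r) /\
  (forall E : bimodHom (restr_bimod phi) (regular_bimod R),
     (forall r : R, phi (E (phi r)) = phi r) <-> phi (E (1 : S)) = 1).
Proof.
split; last by split; [exact: regular_phi_bimodP | exact: phi_quasi_inverseP].
split=> [/quasi_inverse_of_semiseparable[E phiE1]|].
  by apply/regular_phi_bimodP; exists E; apply/phi_quasi_inverseP.
move=> /regular_phi_bimodP[E /phi_quasi_inverseP].
exact: semiseparable_of_quasi_inverse.
Qed.
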